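(* Let $(G_n)_{n\ge 2}$ be a sequence of random graphs following the inverse de-preferential attachment model with $m=1$. Let $\lambda^*>0$ satisfy $\sum_{n=1}^{\infty}\prod_{i=1}^{n}\frac{1}{1+i\lambda^*}=1$. Let $$P_k(n):=\frac1n\sum_{i=1}^n\mathbf{1}\left(d_i(n)=k\right)$$ be the fraction of vertices of $G_n$ with degree $k$. Then for every $k\ge1$, as $n\to\infty$, $$P_k(n)\longrightarrow\frac{k\lambda^*}{k\lambda^*+1}\prod_{i=1}^{k-1}\frac{1}{i\lambda^*+1}\quad\text{almost surely.}$$
   Context: Inverse de-preferential attachment model with $m=1$: the graph $G_n$ has vertices $v_1,\dots,v_n$, and $d_i(n)$ denotes the degree of $v_i$ in $G_n$ (all incident edges and half-edges counted). The process starts from $G_2$, consisting of two vertices $v_1,v_2$ joined by an edge together with one extra ''free'' edge (half-edge) attached to one of the two vertices, which counts toward that vertex's degree; thus the degrees in $G_2$ are $1$ and $2$. Given $G_n$, a new vertex $v_{n+1}$ is added with a single edge $e_{n+1}$ joining it to one of $v_1,\dots,v_n$. With $\mathscr{F}_n$ the natural filtration of the process, $$P(e_{n+1}=\{v_{n+1},v_i\}\mid\mathscr{F}_n)=\frac{C_n}{d_i(n)},\quad i=1,\dots,n,\qquad C_n^{-1}=\sum_{j=1}^n\frac{1}{d_j(n)}.$$ Thus the chosen vertex's degree increases by one and $d_{n+1}(n+1)=1$. Empty products equal $1$. *)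

(* Defs.v *)
From mathcomp Require Import all_boot all_order all_algebra.
From mathcomp Require Import all_classical all_reals all_analysis.
Import Order.TTheory GRing.Theory Num.Theory.
Import numFieldNormedType.Exports.

Set Implicit Arguments.
Unset Strict Implicit.
Unset Printing Implicit Defensive.

Local Open Scope classical_set_scope.
Local Open Scope ring_scope.

(* The vertices v_1, ..., v_nvert are the labels 1, ..., nvert.  The pair (i, j)
   stands for the undirected edge {v_i, v_j}; edges are listed by decreasing
   arrival time.  A half-edge is given by its only end. *)
Record graph := Graph {
  nvert : nat;
  edges : seq (nat * nat);
  half_edges : seq nat }.

Definition deg (g : graph) (i : nat) : nat :=
  (count_mem i (unzip1 (edges g)) + count_mem i (unzip2 (edges g))
   + count_mem i (half_edges g))%N.

Definition graph2 (h : nat) : graph := Graph 2 [:: (2, 1)%N] [:: h].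

Definition attach (g : graph) (i : nat) : graph :=
  Graph (nvert g).+1 (((nvert g).+1, i) :: edges g) (half_edges g).

Section Process.
Context {d : measure_display} {T : measurableType d} {R : realType}.
Variable P : probability T R.

(* X is a version of the conditional probability P(A | F), for a sub-sigma-algebra
   F given as a set of events. *)
Definition is_cond_prob (F : set (set T)) (A : set T) (X : T -> R) : Prop :=
  [/\ forall B : set R, measurable B -> F (X @^-1` B),
      P.-integrable setT (EFin \o X) &
      forall B, F B -> (\int[P]_(w in B) (X w)%:E = P (A `&` B))%E].

Implicit Types G : nat -> T -> graph.

Definition natural_filtration G (n : nat) : set (set T) :=
  <<s [set A | exists m (S : set graph), (2 <= m <= n)%N /\ A = G m @^-1` S] >>.

Definition attach_prob (g : graph) (i : nat) : R :=
  (\sum_(1 <= j < (nvert g).+1) (deg g j)%:R^-1)^-1 / (deg g i)%:R.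

(* G n is the random graph G_n; the values G 0 and G 1 are irrelevant.  The
   vertex of G_2 carrying the half-edge may be random. *)
Record inverse_depreferential G : Prop := InverseDepreferential {
  idp_measurable : forall n (S : set graph), (2 <= n)%N ->
    measurable (G n @^-1` S);
  idp_init : forall w, G 2 w = graph2 1 \/ G 2 w = graph2 2;
  idp_step : forall n w, (2 <= n)%N ->
    exists2 i, (1 <= i <= n)%N & G n.+1 w = attach (G n w) i;
  idp_law : forall n i, (2 <= n)%N -> (1 <= i <= n)%N ->
    is_cond_prob (natural_filtration G n)
      [set w | G n.+1 w = attach (G n w) i]
      (fun w => attach_prob (G n w) i) }.

Definition degree_fraction G (k n : nat) (w : T) : R :=
  n%:R^-1 * \sum_(1 <= i < n.+1) (deg (G n w) i == k)%:R.

End Process.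

(* Main.v *)
(* Let [q_k(n)] be the fraction of vertices of degree larger than [k], and [s_n]
   the mean of the inverse degrees.  The count [n q_k(n)] grows by one with
   conditional probability [(q_{k-1} - q_k) / (k s_n)]; its compensated version is a
   martingale with bounded increments, so its second moment is O(n) and, by
   Borel-Cantelli along the squares, it is o(n) almost surely.

   The rest is deterministic.  If [L = liminf s_n], then inductively
   [limsup q_k <= u_k(L) := \prod_(i <= k) 1 / (1 + i L)].  Since
   [s_n = 1 - \sum_k q_k(n) / (k (k + 1))], summation by parts gives
   [L >= L \sum_k u_k(L)], that is [\sum_k u_k(L) <= 1], hence [L >= lambda].
   Symmetrically [limsup s_n <= lambda].  So [s_n] tends to [lambda], and [q_k] to
   [u_k(lambda)]; the fraction of degree [k] is [q_{k-1} - q_k]. *)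

From HB Require Import structures.
Require Import Defs.
From mathcomp Require Import all_boot all_order all_algebra.
From mathcomp Require Import all_classical all_reals all_analysis.
From mathcomp Require Import ring lra zify.
Import Order.TTheory GRing.Theory Num.Theory.
Import numFieldNormedType.Exports.

Set Implicit Arguments.
Unset Strict Implicit.
Unset Printing Implicit Defensive.

Local Open Scope classical_set_scope.
Local Open Scope ring_scope.

(** * Drift recursions *)

Section LimsupLiminf.
Context {R : realType}.
Implicit Types (x y s Z : nat -> R) (a b c : R).

Definition limsup_le x a := forall e, 0 < e -> \forall n \near \oo, x n <= a + e.
Definition liminf_ge x a := forall e, 0 < e -> \forall n \near \oo, a - e <= x n.

Lemma cvg_limsup_liminf x a : limsup_le x a -> liminf_ge x a -> x @ \oo --> a.
Proof.
move=> xa ax; apply/cvgrPdist_le => e e0.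
by near=> n; rewrite ler_distlC (near (ax e e0) n) ?(near (xa e e0) n).
Unshelve. all: by end_near. Qed.

(** [L] is the supremum of the eventual lower bounds. The last clause is what the bootstrap uses: an
    eventual lower bound derived from [L] itself is again at most [L]. *)
Lemma exists_liminf s a b : (\forall n \near \oo, a <= s n <= b) ->
  exists L, [/\ a <= L, liminf_ge s L &
    forall c, (\forall n \near \oo, c <= s n) -> c <= L].
Proof.
move=> sab; pose E := [set c : R | \forall n \near \oo, c <= s n].
have Ea : E a by apply: filterS sab => n /andP[].
have Eb : ubound E b.
  move=> c Ec; have /filter_ex[n] : \forall n \near \oo, c <= s n <= b.
    near=> n; have /andP[_ ->] : a <= s n <= b by near: n.
    by rewrite andbT; near: n.
  by case/andP; exact: le_trans.
have supE : has_sup E by split; [exists a | exists b].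
exists (sup E); split; first exact: (sup_upper_bound supE).
  move=> e e0; have [c Ec ltc] := sup_adherent e0 supE.
  by apply: filterS Ec => n; apply: le_trans; exact: ltW.
by move=> c Ec; exact: (sup_upper_bound supE).
Unshelve. all: by end_near. Qed.

Lemma exists_limsup s a b : (\forall n \near \oo, a <= s n <= b) ->
  exists L, [/\ a <= L, limsup_le s L &
    forall c, (\forall n \near \oo, s n <= c) -> L <= c].
Proof.
move=> sab.
have /exists_liminf[L [bL infL maxL]] :
    \forall n \near \oo, - b <= (fun n => - s n) n <= - a.
  by apply: filterS sab => n /andP[? ?]; rewrite !lerN2; apply/andP.
exists (- L); split.
- have /filter_ex : \forall n \near \oo, a - 0 <= s n.
    by apply: filterS sab => n /andP[]; rewrite subr0.
  move=> _; rewrite lerNr leNgt; apply/negP => aL.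
  have h0 : 0 < (L + a) / 2 by lra.
  have /filter_ex[n] : \forall n \near \oo, L - (L + a) / 2 <= - s n /\ a <= s n.
    near=> n; split; first exact: (near (infL _ h0) n).
    by have /andP[] : a <= s n <= b by near: n.
  by case=> ? ?; lra.
- by move=> e e0; apply: filterS (infL e e0) => n; lra.
- move=> c sc; rewrite lerNl; apply: maxL.
  by apply: filterS sc => n; rewrite lerN2.
Unshelve. all: by end_near. Qed.

(* Above the line [n * c] the excess [Z n - n * c] cannot grow, so it stays bounded. *)
Lemma slope_le Z B c : (forall n, (2 <= n)%N -> `|Z n.+1 - Z n| <= B) ->
  (\forall n \near \oo, n%:R * c <= Z n -> Z n.+1 <= Z n + c) ->
  forall c', c < c' -> \forall n \near \oo, Z n <= n%:R * c'.
Proof.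
move=> ZB [N _ ZN] c' cc'.
(* [D] covers the excess at time [M] and the most, [B + |c|], by which a single step from below the
   line can overshoot it. *)
pose M := maxn N 2; pose D := Num.max (Z M - M%:R * c) (B + `|c|).
have ZD n : Z (M + n)%N - (M + n)%:R * c <= D.
  elim: n => [|n IH]; first by rewrite addn0 /D le_max lexx.
  have Mn : (2 <= M + n)%N by rewrite (leq_trans (leq_maxr N 2)) ?leq_addr.
  have NM : (N <= M + n)%N by rewrite (leq_trans (leq_maxl N 2)) ?leq_addr.
  have := ZB _ Mn; have := ZN _ NM; rewrite /= addnS -natr1 => ZS.
  have /ler_normlP[c1 c2] := lexx `|c|.
  move=> /ler_normlP[_ h].
  have [ge|lt] := leP ((M + n)%:R * c) (Z (M + n)%N).
    by have := ZS ge; lra.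
  have : B + `|c| <= D by rewrite le_max lexx orbT.
  lra.
near=> n.
have Mn : (M <= n)%N by near: n; exact: nbhs_infty_ge.
have := ZD (n - M)%N; rewrite subnKC // => ZnD.
have : D / (c' - c) <= n%:R by near: n; exact: nbhs_infty_ger.
rewrite ler_pdivrMr ?subr_gt0 //; lra.
Unshelve. all: by end_near. Qed.

(** * Bounds passing through one drift recursion *)

Section Drift.
Variables (kappa : R) (x y s Z : nat -> R).
Hypothesis kappa_ge1 : 1 <= kappa.
Hypothesis x01 : forall n, (2 <= n)%N -> 0 <= x n <= y n.
Hypothesis y01 : forall n, (2 <= n)%N -> y n <= 1.
Hypothesis s_ge : forall n, (2 <= n)%N -> 1 / 2 <= s n.
Hypothesis ZS : forall n, (2 <= n)%N -> Z n.+1 = Z n + (y n - x n) / (kappa * s n).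
Hypothesis xZ : (fun n => x n - Z n / n%:R) @ \oo --> (0 : R).

Let Z_lip n : (2 <= n)%N -> `|Z n.+1 - Z n| <= 2.
Proof.
move=> n2; rewrite ZS // [Z n + _]addrC addrK.
have /andP[x0 xy] := x01 n2; have y1 := y01 n2; have s0 := s_ge n2.
have k1 := kappa_ge1; have ks : 1 / 2 <= kappa * s n by nra.
rewrite ger0_norm; last by apply: divr_ge0; lra.
by rewrite ler_pdivrMr; lra.
Qed.

Let xZ_near e : 0 < e -> \forall n \near \oo, `|x n * n%:R - Z n| <= e * n%:R.
Proof.
move=> e0; have /cvgrPdist_le /(_ e e0) H := xZ.
near=> n.
have n0 : 0 < n%:R :> R by rewrite ltr0n; near: n; exact: nbhs_infty_gt.
have : `|0 - (x n - Z n / n%:R)| <= e by near: n; exact: H.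
rewrite sub0r normrN; have -> : x n - Z n / n%:R = (x n * n%:R - Z n) / n%:R.
  by field; rewrite gt_eqF.
by rewrite normrM normfV (gtr0_norm n0) ler_pdivrMr.
Unshelve. all: by end_near. Qed.

(** Here [x], [y], [kappa] are to be [q k.+1], [q k], [k.+1], and [Z] the compensator. With [x] at
    level [c], the increment of [Z] is at most about [(Y - c) / (kappa * L)], which equals [c]
    exactly at [c = Y / (1 + kappa * L)]. Above that level [Z] grows more slowly than the line of
    slope [c], so [slope_le] applies. *)
Lemma drift_limsup Y L : 0 <= Y -> 0 < L -> limsup_le y Y -> liminf_ge s L ->
  limsup_le x (Y / (1 + kappa * L)).
Proof.
move=> Y0 L0 yY sL e e0; set c := _ + e.
have k1 := kappa_ge1; have kL : 0 < kappa * L by nra.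
have Yc : Y < c * (1 + kappa * L).
  rewrite /c mulrDl divfK; last by apply: lt0r_neq0; lra.
  by nra.
have c0 : 0 < c by rewrite /c ltr_wpDl // divr_ge0 //; lra.
set dl := c * (1 + kappa * L) - Y.
have dl0 : 0 < dl by rewrite /dl; lra.
(* [D] collects the coefficients of [t] in [key], where each of the estimates for [y], [s] and [x]
   is granted an error [t]; [t <= L / 2] keeps [L - t] positive. *)
pose D := 4 + 2 * (kappa * L) + c * kappa.
have D0 : 0 < D by rewrite /D; nra.
pose t := Num.min (L / 2) (dl / D).
have t0 : 0 < t by rewrite lt_min divr_gt0 //= divr_gt0.
have tL : t <= L / 2 by rewrite ge_min lexx.
have tD : t * D <= dl by rewrite -ler_pdivlMr // ge_min lexx orbT.
have key : Y + 2 * t <= (c - 2 * t) * (1 + kappa * (L - t)).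
  have : 0 <= t * t * kappa by rewrite !mulr_ge0 //; lra.
  by move: tD; rewrite /D /dl; lra.
have f0 : 0 < 1 + kappa * (L - t) by rewrite ltr_wpDr // mulr_ge0 //; lra.
have ct : 0 <= c - 2 * t by rewrite -(pmulr_lge0 _ f0); lra.
have H : \forall n \near \oo, n%:R * (c - 2 * t) <= Z n -> Z n.+1 <= Z n + (c - 2 * t).
  near=> n => Zn.
  have n2 : (2 <= n)%N by near: n; exact: nbhs_infty_ge.
  have n0 : 0 < n%:R :> R by rewrite ltr0n; apply: leq_trans n2.
  have hy : y n <= Y + t by near: n; exact: yY.
  have hs : L - t <= s n by near: n; exact: sL.
  have /ler_normlP[hx _] : `|x n * n%:R - Z n| <= t * n%:R by near: n; exact: xZ_near.
  have xc : c - 2 * t - t <= x n by rewrite -(ler_pM2r n0); nra.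
  rewrite ZS // lerD2l ler_pdivrMr; last by have := s_ge n2; nra.
  have : y n - x n <= (c - 2 * t) * (kappa * (L - t)) by lra.
  move/le_trans; apply.
  by rewrite ler_wpM2l // ler_wpM2l //; lra.
have /(_ (c - t)) := slope_le Z_lip H; rewrite ltrD2l ltrN2 => /(_ _)H1.
near=> n.
have n0 : 0 < n%:R :> R by rewrite ltr0n; near: n; exact: nbhs_infty_gt.
have hz : Z n <= n%:R * (c - t) by near: n; apply: H1; lra.
have /ler_normlP[_ hx] : `|x n * n%:R - Z n| <= t * n%:R by near: n; exact: xZ_near.
rewrite -(ler_pM2r n0); nra.
Unshelve. all: by end_near. Qed.

Lemma drift_liminf Y U : 0 <= Y -> 0 < U -> liminf_ge y Y -> limsup_le s U ->
  liminf_ge x (Y / (1 + kappa * U)).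
Proof.
move=> Y0 U0 yY sU e e0; set c := _ - e.
have k1 := kappa_ge1; have kU : 0 < kappa * U by nra.
have Yc : c * (1 + kappa * U) < Y.
  rewrite /c mulrBl divfK; last by apply: lt0r_neq0; lra.
  by nra.
(* A negative level is trivial because [x] is nonnegative; the remaining case mirrors the upper
   bound, with [slope_le] applied to [- Z]. *)
have [c0|c0] := ltP c 0.
  near=> n; apply: (le_trans (ltW c0)).
  have n2 : (2 <= n)%N by near: n; exact: nbhs_infty_ge.
  by case/andP: (x01 n2).
set dl := Y - c * (1 + kappa * U).
have dl0 : 0 < dl by rewrite /dl; lra.
(* The extra [2 * kappa] absorbs the quadratic term [2 * t * t * kappa], which has the unfavourable
   sign here; this is why [t <= 1] is imposed. *)
pose D := 4 + 2 * (kappa * U) + c * kappa + 2 * kappa.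
have D0 : 0 < D by rewrite /D; nra.
pose t := Num.min 1 (dl / D).
have t0 : 0 < t by rewrite lt_min ltr01 //= divr_gt0.
have t1 : t <= 1 by rewrite ge_min lexx.
have tD : t * D <= dl by rewrite -ler_pdivlMr // ge_min lexx orbT.
have key : (c + 2 * t) * (1 + kappa * (U + t)) <= Y - 2 * t.
  have : 0 <= (1 - t) * (t * kappa) by rewrite !mulr_ge0 //; lra.
  by move: tD; rewrite /D /dl; lra.
have H : \forall n \near \oo, n%:R * - (c + 2 * t) <= - Z n ->
    - Z n.+1 <= - Z n - (c + 2 * t).
  near=> n => Zn.
  have n2 : (2 <= n)%N by near: n; exact: nbhs_infty_ge.
  have n0 : 0 < n%:R :> R by rewrite ltr0n; apply: leq_trans n2.
  have hy : Y - t <= y n by near: n; exact: yY.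
  have hs : s n <= U + t by near: n; exact: sU.
  have /ler_normlP[_ hx] : `|x n * n%:R - Z n| <= t * n%:R by near: n; exact: xZ_near.
  have xc : x n <= c + 2 * t + t by rewrite -(ler_pM2r n0); nra.
  rewrite ZS // opprD lerD2l lerN2 ler_pdivlMr; last by have := s_ge n2; nra.
  have : (c + 2 * t) * (kappa * (U + t)) <= y n - x n by lra.
  apply: le_trans.
  by rewrite ler_wpM2l ?ler_wpM2l //; lra.
have Z_lip' n : (2 <= n)%N -> `|- Z n.+1 - - Z n| <= 2.
  by move=> n2; rewrite opprK addrC distrC Z_lip.
have /(_ (- (c + t))) := @slope_le (fun n => - Z n) _ _ Z_lip' H.
rewrite ltrN2 ltrD2l => /(_ _)H1.
near=> n.
have n0 : 0 < n%:R :> R by rewrite ltr0n; near: n; exact: nbhs_infty_gt.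
have hz : - Z n <= n%:R * - (c + t) by near: n; apply: H1; lra.
have /ler_normlP[hx _] : `|x n * n%:R - Z n| <= t * n%:R by near: n; exact: xZ_near.
rewrite -(ler_pM2r n0); nra.
Unshelve. all: by end_near. Qed.

End Drift.

End LimsupLiminf.

(** * The deterministic degree recursion *)

Section TailProduct.
Context {R : realType}.
Implicit Types (L x : R).

Definition tail_prod L k := \prod_(1 <= i < k.+1) (1 / (1 + i%:R * L)).

Lemma tail_prodS L k : 0 < L -> tail_prod L k = (1 + k.+1%:R * L) * tail_prod L k.+1.
Proof.
move=> L0; rewrite /tail_prod [in RHS]big_nat_recr //= mulrCA mul1r divff ?mulr1 //.
by rewrite gt_eqF // ltr_wpDr // mulr_ge0 // ltW.
Qed.

Lemma tail_prod_gt0 L k : 0 < L -> 0 < tail_prod L k.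
Proof.
move=> L0; rewrite /tail_prod; apply: prodr_gt0 => i _.
by rewrite divr_gt0 // ltr_wpDr // mulr_ge0 // ltW.
Qed.

Lemma tail_prod_le1 L k : 0 < L -> tail_prod L k <= 1.
Proof.
move=> L0; rewrite /tail_prod; apply: prodr_ile1 => i _.
have iL : 0 <= i%:R * L by rewrite mulr_ge0 // ltW.
by rewrite divr_ge0 ?addr_ge0 //= ler_pdivrMr ?mul1r ?lerDl // ltr_wpDr.
Qed.

Lemma tail_prod_anti L x k : 0 < L -> L <= x -> tail_prod x k <= tail_prod L k.
Proof.
move=> L0 Lx; have x0 := lt_le_trans L0 Lx.
rewrite /tail_prod; apply: ler_prod => i _.
have iL : 0 <= i%:R * L by rewrite mulr_ge0 // ltW.
have ix : i%:R * L <= i%:R * x by rewrite ler_wpM2l.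
rewrite divr_ge0 //=; last by lra.
by rewrite !mul1r lef_pV2 ?posrE; lra.
Qed.

Definition tail_sum L K : R := \sum_(1 <= k < K.+1) tail_prod L k.

(** If [u k] is the fraction of degrees above [k], then [1 - weighted_tail u K] is the mean of
    [1 / min(d, K + 1)], the truncated inverse degree. *)
Definition weighted_tail (u : nat -> R) K : R :=
  \sum_(1 <= k < K.+1) u k / (k%:R * k.+1%:R).

(** Summation by parts, using [u_(k-1) - u_k = k * L * u_k] and
    [1 / (k * (k + 1)) = 1 / k - 1 / (k + 1)]; the last term is the boundary term. *)
Lemma tail_prod_sum L K : 0 < L ->
  1 - weighted_tail (tail_prod L) K =
  L * tail_sum L K + tail_prod L K / K.+1%:R.
Proof.
move=> L0; rewrite /weighted_tail /tail_sum; elim: K => [|K IH].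
  by rewrite !big_geq // subr0 mulr0 add0r /tail_prod big_geq // divr1.
rewrite big_nat_recr //= [in RHS]big_nat_recr //= opprD addrA IH (tail_prodS K L0).
rewrite -[K.+2%:R]natr1 -[K.+1%:R]natr1; have K0 : 0 <= K%:R :> R by [].
by field; rewrite !gt_eqF //; lra.
Qed.

(** Keeping the loss in the first term gives a gap independent of [K], so strictness survives the
    limit in [K]. *)
Lemma tail_prod_sum_anti L x K : 0 < L -> L < x -> (0 < K)%N ->
  tail_sum x K <=
  tail_sum L K - (tail_prod L 1 - tail_prod x 1).
Proof.
move=> L0 Lx K0; rewrite /tail_sum !(big_ltn (m := 1)) ?ltnS //.
suff : \sum_(2 <= i < K.+1) tail_prod x i <= \sum_(2 <= i < K.+1) tail_prod L i by lra.
by apply: ler_sum => i _; apply: tail_prod_anti => //; exact: ltW.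
Qed.

Lemma tail_prod1_lt L x : 0 < L -> L < x -> tail_prod x 1 < tail_prod L 1.
Proof.
move=> L0 Lx; rewrite /tail_prod !big_nat1 !mul1r ltf_pV2 ?posrE; lra.
Qed.

End TailProduct.

(** * Squeezing the mean inverse degree *)

Section DegreeRecursion.
Context {R : realType}.
Variables (lambda : R) (q Z : nat -> nat -> R) (s : nat -> R).
Hypothesis lambda_gt0 : 0 < lambda.
Hypothesis hlambda :
  (fun N : nat => \sum_(1 <= n < N.+1) tail_prod lambda n) @ \oo --> (1 : R).
Hypothesis q0 : forall n, (2 <= n)%N -> q 0 n = 1.
Hypothesis q_anti : forall k n, (2 <= n)%N -> 0 <= q k.+1 n <= q k n.
Hypothesis s_ge : forall n, (2 <= n)%N -> 1 / 2 <= s n.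
Hypothesis s_sum : forall K n, (2 <= n)%N ->
  s n <= 1 - weighted_tail (q^~ n) K <= s n + K.+1%:R^-1.
Hypothesis ZS : forall k n, (2 <= n)%N ->
  Z k.+1 n.+1 = Z k.+1 n + (q k n - q k.+1 n) / (k.+1%:R * s n).
Hypothesis qZ : forall k, (fun n => q k.+1 n - Z k.+1 n / n%:R) @ \oo --> (0 : R).

Let q01 k n : (2 <= n)%N -> 0 <= q k n <= 1.
Proof.
move=> n2; elim: k => [|k /andP[IH1 IH2]]; first by rewrite q0 // ler01 lexx.
by have /andP[-> h] := q_anti k n2; rewrite (le_trans h).
Qed.

Let s01 : \forall n \near \oo, 1 / 2 <= s n <= 1.
Proof.
near=> n; have n2 : (2 <= n)%N by near: n; exact: nbhs_infty_ge.
by rewrite s_ge //=; have := s_sum 0 n2; rewrite /weighted_tail big_geq // subr0; case/andP.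
Unshelve. all: by end_near. Qed.

Let tail_prod_div (L : R) k : 0 < L -> tail_prod L k / (1 + k.+1%:R * L) = tail_prod L k.+1.
Proof.
move=> L0; rewrite (tail_prodS k L0) mulrC mulKf // gt_eqF // ltr_wpDr //.
by rewrite mulr_ge0 // ltW.
Qed.

Let k_ge1 k : 1 <= k.+1%:R :> R.
Proof. by rewrite ler1n. Qed.

Let q_limsup (L : R) k : 0 < L -> liminf_ge s L -> limsup_le (q k) (tail_prod L k).
Proof.
move=> L0 sL; elim: k => [|k IH].
  move=> e e0; near=> n; have n2 : (2 <= n)%N by near: n; exact: nbhs_infty_ge.
  by rewrite q0 // /tail_prod big_geq // lerDl ltW.
rewrite -tail_prod_div //.
apply: (drift_limsup (k_ge1 k) (@q_anti k) _ s_ge (@ZS k) (qZ k)) => //.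
  by move=> n /(q01 k) /andP[].
exact/ltW/tail_prod_gt0.
Unshelve. all: by end_near. Qed.

Let q_liminf (U : R) k : 0 < U -> limsup_le s U -> liminf_ge (q k) (tail_prod U k).
Proof.
move=> U0 sU; elim: k => [|k IH].
  move=> e e0; near=> n; have n2 : (2 <= n)%N by near: n; exact: nbhs_infty_ge.
  by rewrite q0 // /tail_prod big_geq // gerBl ltW.
rewrite -tail_prod_div //.
apply: (drift_liminf (k_ge1 k) (@q_anti k) _ s_ge (@ZS k) (qZ k)) => //.
  by move=> n /(q01 k) /andP[].
exact/ltW/tail_prod_gt0.
Unshelve. all: by end_near. Qed.

Let weight_sum_le1 K : \sum_(1 <= k < K.+1) (k%:R * k.+1%:R)^-1 <= 1 :> R.
Proof.
suff -> : \sum_(1 <= k < K.+1) (k%:R * k.+1%:R)^-1 = 1 - K.+1%:R^-1 :> R.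
  by rewrite gerBl invr_ge0.
elim: K => [|K IH]; first by rewrite big_geq // invr1 subrr.
rewrite big_nat_recr //= IH -[K.+2%:R]natr1 -[K.+1%:R]natr1.
have K0 : 0 <= K%:R :> R by [].
by field; rewrite !gt_eqF //; lra.
Qed.

(** The weights have total mass at most one, so a uniform error is not amplified. *)
Let weighted_tail_le (u v : nat -> R) (e : R) K : 0 <= e ->
  (forall k, (k < K.+1)%N -> u k <= v k + e) ->
  weighted_tail u K <= weighted_tail v K + e.
Proof.
rewrite /weighted_tail.
move=> e0 uv; have := ler_wpM2l e0 (weight_sum_le1 K).
rewrite mulr1 => we; apply: le_trans (lerD (lexx _) we).
rewrite mulr_sumr -big_split /= ler_sum_nat // => k /andP[k1 kK].
by rewrite -mulrDl ler_wpM2r ?uv // invr_ge0 mulr_ge0.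
Qed.

Let near_all_lt (A : nat -> nat -> Prop) K :
  (forall k, \forall n \near \oo, A k n) ->
  \forall n \near \oo, forall k, (k < K)%N -> A k n.
Proof.
move=> HA; elim: K => [|K IH]; first exact: nearW.
near=> n => k; rewrite ltnS leq_eqVlt => /orP[/eqP -> |].
  by near: n; exact: HA.
by move: k; near: n.
Unshelve. all: by end_near. Qed.

Let tail_sum_near (d d' : R) : 0 < d -> 0 < d' -> \forall K \near \oo,
  [/\ (0 < K)%N, `|1 - tail_sum lambda K| <= d & K.+1%:R^-1 <= d'].
Proof.
move=> d0 d'0; near=> K; split; first by near: K; exact: nbhs_infty_gt.
  by near: K; move/cvgrPdist_le: hlambda; apply.
rewrite invf_ple ?posrE //; apply: (@le_trans _ _ K%:R); last by rewrite ler_nat.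
by near: K; exact: nbhs_infty_ger.
Unshelve. all: by end_near. Qed.

Let s_liminf : liminf_ge s lambda.
Proof.
have [L [L2 sL maxL]] := exists_liminf s01.
have L0 : 0 < L by lra.
suff lL : lambda <= L by move=> e e0; apply: filterS (sL e e0) => n; lra.
rewrite leNgt; apply/negP => Ll.
(* One [K.+1%:R^-1] pays for the truncation in [s_sum], the other for the tolerance in [q_limsup];
   the boundary term is nonnegative and is dropped. *)
have self K : L * tail_sum L K - 2 * K.+1%:R^-1 <= L.
  have e0 : 0 < K.+1%:R^-1 :> R by rewrite invr_gt0.
  apply: maxL; near=> n; have n2 : (2 <= n)%N by near: n; exact: nbhs_infty_ge.
  have /(weighted_tail_le (ltW e0)) :
      forall k, (k < K.+1)%N -> q k n <= tail_prod L k + K.+1%:R^-1.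
    by near: n; apply: near_all_lt => k; exact: q_limsup.
  have := tail_prod_sum K L0; have /andP[_] := s_sum K n2.
  have : 0 <= tail_prod L K / K.+1%:R by rewrite divr_ge0 // ltW // tail_prod_gt0.
  set r := K.+1%:R^-1; set T := tail_prod _ _ * _; lra.
(* If [L < lambda], a large [K] gives [tail_sum L K >= 1 + 7/8 * dl], while the error in [self] is
   at most [L * dl / 4]: together they contradict [self]. *)
have := tail_prod1_lt L0 Ll; rewrite -subr_gt0; set dl := _ - _ => dl0.
have d0 : 0 < L * dl / 8 by rewrite divr_gt0 // mulr_gt0.
have d0' : 0 < dl / 8 by rewrite divr_gt0.
have /filter_ex[K [K0 /ler_normlP[_ cl]]] := tail_sum_near d0' d0.
set r := K.+1%:R^-1 => rd.
have := self K; rewrite -/r; have := tail_prod_sum_anti L0 Ll K0; rewrite -/dl => h.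
have : L * (1 + 7 / 8 * dl) <= L * tail_sum L K.
  by rewrite ler_pM2l //; lra.
have : 0 < L * dl by rewrite mulr_gt0.
lra.
Unshelve. all: by end_near. Qed.

Let s_limsup : limsup_le s lambda.
Proof.
have [U [U2 sU minU]] := exists_limsup s01.
have U0 : 0 < U by lra.
suff lU : U <= lambda by move=> e e0; apply: filterS (sU e e0) => n; lra.
rewrite leNgt; apply/negP => lU.
(* Here truncation costs nothing; the two errors are the boundary term of [tail_prod_sum] and the
   tolerance in [q_liminf]. *)
have self K : U <= U * tail_sum U K + 2 * K.+1%:R^-1.
  have e0 : 0 < K.+1%:R^-1 :> R by rewrite invr_gt0.
  apply: minU; near=> n; have n2 : (2 <= n)%N by near: n; exact: nbhs_infty_ge.
  have /(weighted_tail_le (ltW e0)) :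
      forall k, (k < K.+1)%N -> tail_prod U k <= q k n + K.+1%:R^-1.
    near: n; apply: near_all_lt => k; apply: filterS (q_liminf k U0 sU e0) => n.
    by rewrite lerBlDr.
  have := tail_prod_sum K U0; have /andP[+ _] := s_sum K n2.
  have : tail_prod U K / K.+1%:R <= 1 / K.+1%:R.
    by rewrite ler_wpM2r ?tail_prod_le1 // ltW.
  set r := K.+1%:R^-1; set T := tail_prod _ _ * _; lra.
have := tail_prod1_lt lambda_gt0 lU; rewrite -subr_gt0; set dl := _ - _ => dl0.
have d0 : 0 < U * dl / 8 by rewrite divr_gt0 // mulr_gt0.
have d0' : 0 < dl / 8 by rewrite divr_gt0.
have /filter_ex[K [K0 /ler_normlP[cl _]]] := tail_sum_near d0' d0.
set r := K.+1%:R^-1 => rd.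
have := self K; rewrite -/r; have := tail_prod_sum_anti lambda_gt0 lU K0; rewrite -/dl => h.
have : U * tail_sum U K <= U * (1 - 7 / 8 * dl).
  by rewrite ler_pM2l //; lra.
have : 0 < U * dl by rewrite mulr_gt0.
lra.
Unshelve. all: by end_near. Qed.

Lemma degree_recursion_cvg k : q k @ \oo --> tail_prod lambda k.
Proof. by apply: cvg_limsup_liminf; [exact: q_limsup | exact: q_liminf]. Qed.

End DegreeRecursion.

(** * Degree counts of reachable graphs *)

HB.instance Definition _ := gen_eqMixin graph.

(* The graphs of [reachable n] have [n.+2] vertices. *)
Fixpoint reachable n : seq graph :=
  if n is n'.+1 then [seq attach g i | g <- reachable n', i <- index_iota 1 n'.+3]
  else [:: graph2 1; graph2 2].

Lemma reachableSP n g : reflect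
  (exists h i, [/\ h \in reachable n, (1 <= i <= n.+2)%N & g = attach h i])
  (g \in reachable n.+1).
Proof.
apply: (iffP allpairsPdep) => -[h [i [hn iN ->]]]; exists h, i; split => //;
  by move: iN; rewrite mem_index_iota.
Qed.

Lemma deg_attach g i j :
  deg (attach g i) j = (deg g j + (j == (nvert g).+1) + (j == i))%N.
Proof. rewrite /deg /attach /= ![_ == j]eq_sym; lia. Qed.

(** A nonempty edge list lets the compensator recursion unfold by one step; degree zero beyond [n]
    makes the next vertex start with degree one. *)
Definition well_formed n g :=
  [/\ nvert g = n, edges g != [::], forall i, (1 <= i <= n)%N -> (1 <= deg g i)%N
    & forall i, (n < i)%N -> deg g i = 0%N].

Lemma well_formed_attach n g i : well_formed n g -> (1 <= i <= n)%N ->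
  well_formed n.+1 (attach g i).
Proof.
case=> <- _ deg1 deg0 /andP[i1 iN]; split => //= j.
  rewrite deg_attach => /andP[j1]; rewrite leq_eqVlt => /orP[/eqP -> |].
    by rewrite eqxx; lia.
  by rewrite ltnS => jN; have := deg1 j; rewrite j1 jN => /(_ isT); lia.
by move=> jN; rewrite deg_attach deg0; lia.
Qed.

Lemma well_formed_reachable n g : g \in reachable n -> well_formed n.+2 g.
Proof.
elim: n g => [|n IH] g.
  rewrite !inE => /orP[] /eqP ->; split => //.
  - by case=> [|[|[|i]]].
  - by case=> [|[|[|i]]].
  - by case=> [|[|[|i]]].
  - by case=> [|[|[|i]]].
by case/reachableSP => h [i [/IH hh iN ->]]; exact: well_formed_attach.
Qed.

(** * Sums over degrees and the compensated tail counts *)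

Section DegreeSums.
Context {R : realType}.
Implicit Types (F : nat -> R) (g : graph).

Definition deg_sum F g := \sum_(1 <= j < (nvert g).+1) F (deg g j).

Lemma deg_sum_attach F n g i : well_formed n g -> (1 <= i <= n)%N ->
  deg_sum F (attach g i) = deg_sum F g + F 1%N + F (deg g i).+1 - F (deg g i).
Proof.
case=> gn _ _ deg0 iN; rewrite /deg_sum /= gn big_nat_recr //=.
have i_in : i \in index_iota 1 n.+1 by rewrite mem_index_iota; lia.
rewrite !(bigD1_seq i) ?iota_uniq //=.
have -> : deg (attach g i) n.+1 = 1%N.
  by rewrite deg_attach gn eqxx deg0 //; lia.
have -> : deg (attach g i) i = (deg g i).+1.
  by rewrite deg_attach gn eqxx; lia.
have -> : \sum_(j <- index_iota 1 n.+1 | j != i) F (deg (attach g i) j) =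
          \sum_(j <- index_iota 1 n.+1 | j != i) F (deg g j).
  rewrite big_seq_cond [RHS]big_seq_cond; apply: eq_bigr => j.
  rewrite mem_index_iota => /andP[jN /negbTE ji].
  by rewrite deg_attach gn ji addn0 (_ : (j == n.+1) = false) ?addn0 //; lia.
by ring.
Qed.

Lemma attach_probE g i :
  attach_prob g i = (deg_sum (fun d => d%:R^-1) g)^-1 / (deg g i)%:R :> R.
Proof. by []. Qed.

(** An attachment adds [1] for the new vertex and loses [1 / m - 1 / (m + 1) <= 1 / 2] at the chosen
    one, a net gain of at least [1 / 2]. *)
Lemma deg_sum_inv_ge n g : g \in reachable n ->
  n.+2%:R / 2 <= deg_sum (fun d => d%:R^-1) g :> R.
Proof.
elim: n g => [|n IH] g.
  rewrite !inE /deg_sum => /orP[] /eqP ->; rewrite big_nat_recr // big_nat1.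
    by rewrite (_ : deg _ 1 = 2%N) // (_ : deg _ 2 = 1%N) //=; lra.
  by rewrite (_ : deg _ 1 = 1%N) // (_ : deg _ 2 = 2%N) //=; lra.
case/reachableSP => h [i [hn iN ->]].
have wfh := well_formed_reachable hn; have := IH _ hn.
rewrite (deg_sum_attach _ wfh) //.
set S := deg_sum _ _; have : (1 <= deg h i)%N by case: wfh => _ _ + _; apply.
case: (deg h i) => // m _; rewrite -[n.+3%:R]natr1 -[m.+2%:R]natr1 invr1.
have m1 : 1 <= m.+1%:R :> R by rewrite ler1n.
have : m.+1%:R^-1 - (m.+1%:R + 1)^-1 <= 1 / 2 :> R.
  have -> : m.+1%:R^-1 - (m.+1%:R + 1)^-1 = (m.+1%:R * (m.+1%:R + 1))^-1 :> R.
    by field; rewrite !gt_eqF //; lra.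
  by rewrite div1r lef_pV2 ?posrE //; nra.
set a := m.+1%:R^-1; set b := (m.+1%:R + 1)^-1 => ab; lra.
Qed.

Lemma deg_sum_inv_gt0 n g : g \in reachable n -> 0 < deg_sum (fun d => d%:R^-1) g :> R.
Proof. by move/deg_sum_inv_ge; apply: lt_le_trans; rewrite divr_gt0. Qed.

Lemma attach_prob_ge0 g i : 0 <= attach_prob g i :> R.
Proof. by rewrite divr_ge0 // invr_ge0 sumr_ge0. Qed.

Lemma sum_attach_prob n g : g \in reachable n ->
  \sum_(1 <= i < n.+3) attach_prob g i = 1 :> R.
Proof.
move=> gn; have S0 := deg_sum_inv_gt0 gn.
have [gv _ _ _] := well_formed_reachable gn.
under eq_bigr do rewrite attach_probE; rewrite -mulr_sumr -gv.
by rewrite mulVf // gt_eqF.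
Qed.

Definition num_deg_gt k g := deg_sum (fun d => (k < d)%:R) g.

(** The conditional probability that the next edge lands on a vertex of degree [k], hence the drift
    of the number of degrees above [k]. *)
Definition rate k g := \sum_(1 <= i < (nvert g).+1) (deg g i == k)%:R * attach_prob g i : R.

Lemma rateE n k g : g \in reachable n ->
  rate k.+1 g = (num_deg_gt k g - num_deg_gt k.+1 g)
    / (k.+1%:R * deg_sum (fun d => d%:R^-1) g).
Proof.
move=> gn; rewrite /num_deg_gt /deg_sum -sumrB mulr_suml; apply: eq_bigr => i _.
rewrite attach_probE; have [->|neq] := eqVneq (deg g i) k.+1.
  by rewrite mul1r ltnSn ltnn subr0 mul1r invfM mulrC.
rewrite mul0r (_ : (k < deg g i)%N = (k.+1 < deg g i)%N) ?subrr ?mul0r //.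
by move: neq; lia.
Qed.

Lemma rate_ge0 k g : 0 <= rate k g.
Proof. by apply: sumr_ge0 => i _; rewrite mulr_ge0 // attach_prob_ge0. Qed.

Lemma rate_le1 n k g : g \in reachable n -> rate k g <= 1.
Proof.
move=> gn; have [gv _ _ _] := well_formed_reachable gn.
rewrite -(sum_attach_prob gn) /rate gv; apply: ler_sum => i _.
by rewrite ler_piMl ?attach_prob_ge0 // lern1 leq_b1.
Qed.

(* The edge list records the whole history, so the compensator of [num_deg_gt k]
   is a function of the current graph.  The oldest edge belongs to the initial
   graph and contributes nothing. *)
Fixpoint compensator_rec k (es : seq (nat * nat)) n h : R :=
  if es is _ :: es' then
    if es' is _ :: _ then compensator_rec k es' n.-1 h + rate k (Graph n.-1 es' h)
    else 0
  else 0.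

Definition compensator k g := compensator_rec k (edges g) (nvert g) (half_edges g).

Definition deg_martingale k g := num_deg_gt k g - compensator k g.

Lemma compensator_attach k g i : edges g != [::] ->
  compensator k (attach g i) = compensator k g + rate k g.
Proof. by case: g => n [|e es] h. Qed.

Lemma num_deg_gt_attach k n g i : well_formed n g -> (1 <= i <= n)%N ->
  num_deg_gt k.+1 (attach g i) = num_deg_gt k.+1 g + (deg g i == k.+1)%:R.
Proof.
move=> wg iN; rewrite /num_deg_gt (deg_sum_attach _ wg) // [(k.+1 < (deg g i).+1)%N]ltnS.
by case: (ltngtP (deg g i) k.+1) => _ /=; ring.
Qed.

Lemma deg_martingale_attach k n g i : well_formed n g -> (1 <= i <= n)%N ->
  deg_martingale k.+1 (attach g i) =
  deg_martingale k.+1 g + ((deg g i == k.+1)%:R - rate k.+1 g).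
Proof.
move=> wg iN; have [_ g0 _ _] := wg.
by rewrite /deg_martingale (num_deg_gt_attach _ wg) // compensator_attach //; ring.
Qed.

(** The sum telescopes, since only the [k < d] contribute: the middle term is the inverse of
    [minn d K.+1]. *)
Lemma truncated_inv K d : (1 <= d)%N ->
  (d%:R^-1 : R) <= 1 - weighted_tail (fun k => (k < d)%:R : R) K <= d%:R^-1 + K.+1%:R^-1.
Proof.
move=> d1; have -> : 1 - weighted_tail (fun k => (k < d)%:R : R) K = (minn d K.+1)%:R^-1 :> R.
  rewrite /weighted_tail; elim: K => [|K IH].
    by rewrite big_geq // subr0 (minn_idPr d1) invr1.
  rewrite big_nat_recr //= opprD addrA IH; have [Kd|dK] := ltnP K.+1 d.
    rewrite (minn_idPr Kd) /= -[K.+2%:R]natr1.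
    have K0 : 1 <= K.+1%:R :> R by rewrite ler1n.
    by field; rewrite !gt_eqF //; lra.
  by rewrite mul0r subr0 (minn_idPl (leqW dK)).
have K0 : 0 <= K.+1%:R^-1 :> R by rewrite invr_ge0.
have d0 : 0 <= d%:R^-1 :> R by rewrite invr_ge0.
by have [Kd|dK] := leqP d K.+1; rewrite ?lerDl ?lexx ?lerDr ?d0 ?K0 ?andbT //=
  lef_pV2 ?posrE ?ltr0n // ler_nat ltnW.
Qed.

End DegreeSums.

(** * Trajectories of graphs *)

Section GraphPath.
Variable g : nat -> graph.
Hypothesis g2 : g 2 = graph2 1 \/ g 2 = graph2 2.
Hypothesis gS : forall n, (2 <= n)%N -> exists2 i, (1 <= i <= n)%N & g n.+1 = attach (g n) i.

Lemma reachable_path n : g n.+2 \in reachable n.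
Proof.
elim: n => [|n IH]; first by case: g2 => ->; rewrite !inE eqxx ?orbT.
by have [//|i iN ->] := gS (_ : (2 <= n.+2)%N); apply/reachableSP; exists (g n.+2), i.
Qed.

Let reachable_ge2 n : (2 <= n)%N -> g n \in reachable n.-2.
Proof. by case: n => [|[|n]] // _; exact: reachable_path. Qed.

Lemma well_formed_path n : (2 <= n)%N -> well_formed n (g n).
Proof. by case: n => [|[|n]] // _; exact/well_formed_reachable/reachable_path. Qed.

Context {R : realType}.

Lemma deg_martingale_path_lip k n : (2 <= n)%N ->
  `|deg_martingale k.+1 (g n.+1) - deg_martingale k.+1 (g n)| <= 1 :> R.
Proof.
move=> n2; have [i iN ->] := gS n2.
rewrite (deg_martingale_attach _ (well_formed_path n2)) // addrC addKr.
have := rate_ge0 (R := R) k.+1 (g n); have := rate_le1 (R := R) k.+1 (reachable_ge2 n2).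
by move=> ? ?; case: eqP => _ /=; rewrite ler_norml; lra.
Qed.

(** Along a trajectory the compensator satisfies the drift recursion exactly, and the hypothesis on
    the martingale says that it tracks the tail count up to o(n). *)
Lemma frac_deg_gt_cvg (lambda : R) : 0 < lambda ->
  (fun N => tail_sum lambda N) @ \oo --> (1 : R) ->
  (forall k, (fun n => deg_martingale k.+1 (g n) / n%:R) @ \oo --> (0 : R)) ->
  forall k, (fun n => num_deg_gt k (g n) / n%:R) @ \oo --> tail_prod lambda k.
Proof.
move=> l0 hl mart k.
have n0 n : (2 <= n)%N -> n%:R != 0 :> R by rewrite pnatr_eq0; case: n.
have np n : (2 <= n)%N -> 0 < n%:R :> R by rewrite ltr0n; case: n.
apply: (@degree_recursion_cvg _ lambda (fun k n => num_deg_gt k (g n) / n%:R)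
  (fun k n => compensator k (g n))
  (fun n => deg_sum (fun d => d%:R^-1) (g n) / n%:R)) => //.
- move=> n n2; have [gv _ deg1 _] := well_formed_path n2.
  rewrite /num_deg_gt /deg_sum gv (eq_big_nat _ _ (F2 := fun=> 1)) => [|i iN].
    by rewrite big_const_nat iter_addr_0 subn1 divff ?n0.
  by rewrite deg1.
- move=> j n n2; rewrite ler_pM2r ?invr_gt0 ?np // divr_ge0 //=; last first.
    by apply: sumr_ge0 => i _.
  apply: ler_sum => i _; rewrite ler_nat.
  by case: ltnP => // /ltnW ->.
- move=> n n2; rewrite ler_pdivlMr ?np //.
  by have := deg_sum_inv_ge (R := R) (reachable_ge2 n2); case: n n2 => [|[|n]] //= _; lra.
(* The bounds on [s] are those of [truncated_inv] averaged over the vertices. *)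
- move=> K n n2; have [gv _ deg1 _] := well_formed_path n2.
  have -> : 1 - weighted_tail (fun k => num_deg_gt k (g n) / n%:R) K =
      (\sum_(1 <= i < n.+1) (1 - weighted_tail (fun k => (k < deg (g n) i)%:R) K)) / n%:R :> R.
    rewrite sumrB mulrBl big_const_nat iter_addr_0 subn1 /= divff ?n0 //.
    congr (_ - _); rewrite /weighted_tail exchange_big /= mulr_suml.
    apply: eq_bigr => i _; rewrite mulrAC; congr (_ * _).
    by rewrite /num_deg_gt /deg_sum gv mulr_suml.
  have -> : deg_sum (fun d => d%:R^-1) (g n) / n%:R + K.+1%:R^-1 =
      (\sum_(1 <= i < n.+1) ((deg (g n) i)%:R^-1 + K.+1%:R^-1)) / n%:R :> R.
    rewrite big_split /= mulrDl /deg_sum gv; congr (_ + _).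
    by rewrite big_const_nat iter_addr_0 subn1 /= -[X in X / _]mulr_natr mulfK ?n0.
  rewrite /deg_sum gv !ler_pM2r ?invr_gt0 ?np //; apply/andP; split;
    by apply: ler_sum_nat => i iN; have /andP[] := truncated_inv (R := R) K (deg1 i iN).
- move=> j n n2; have [i iN ->] := gS n2; have [_ gn _ _] := well_formed_path n2.
  rewrite compensator_attach // (rateE _ (reachable_ge2 n2)); congr (_ + _).
  have S0 := deg_sum_inv_gt0 (R := R) (reachable_ge2 n2).
  have j1 : 1 <= j.+1%:R :> R by rewrite ler1n.
  by field; rewrite n0 // !gt_eqF //; lra.
- move=> j; rewrite (_ : (fun n => _) = fun n => deg_martingale j.+1 (g n) / n%:R) //.
  by apply/funext => n; rewrite -mulrBl.
Qed.

End GraphPath.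

(** * Interpolation between squares *)

Lemma square_bracket n : exists j, (j ^ 2 <= n < j.+1 ^ 2)%N.
Proof.
elim: n => [|n [j /andP[jn nj]]]; first by exists 0%N.
have [h|h] := ltnP n.+1 (j.+1 ^ 2); first by exists j; rewrite h (leq_trans jn).
by exists j.+1; rewrite h /=; nia.
Qed.

(** From [j ^ 2] to any time before [j.+1 ^ 2] there are at most [2 * j] unit steps, negligible
    against [j ^ 2]. *)
Lemma lipschitz_cvg_of_squares {R : realType} (M : nat -> R) :
  (forall n, (2 <= n)%N -> `|M n.+1 - M n| <= 1) ->
  (forall l, \forall j \near \oo, `|M (j.+2 ^ 2)%N| < l.+1%:R^-1 * (j.+2 ^ 2)%:R) ->
  (fun n => M n / n%:R) @ \oo --> (0 : R).
Proof.
move=> Mlip Msq; apply/cvgrPdist_le => e e0.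
have [l le] : exists l, l.+1%:R^-1 <= e / 2.
  have e2 : 0 < e / 2 by rewrite divr_gt0.
  by have [l _ /(_ l (leqnn l)) /ltW] := near_infty_natSinv_lt (PosNum e2); exists l.
have [J _ HJ] := Msq l.
(* [4 / e <= j] turns the drift [2 * j] into at most [e / 2 * j ^ 2]; [J.+2] undoes the shift in the
   indexing of the squares. *)
have /filter_ex[j0 [jJ je]] : \forall j \near \oo, (J.+2 <= j)%N /\ 4 / e <= j%:R.
  near=> j; split; near: j; [exact: nbhs_infty_ge | exact: nbhs_infty_ger].
near=> n; rewrite sub0r normrN normrM normfV.
have nj : (j0 ^ 2 <= n)%N by near: n; exact: nbhs_infty_ge.
have [j /andP[jn nj1]] := square_bracket n.
have jj0 : (j0 <= j)%N by nia.
have Mdiff m : `|M (j ^ 2 + m)%N - M (j ^ 2)%N| <= m%:R.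
  elim: m => [|m IH]; first by rewrite addn0 subrr normr0.
  rewrite addnS -natr1 -(subrKA (M (j ^ 2 + m)%N)) addrC.
  by apply: le_trans (ler_normD _ _) _; apply: lerD => //; apply: Mlip; nia.
have jE : j = (j - 2).+2 by lia.
have Jj : (J <= j - 2)%N by lia.
have := HJ _ Jj; rewrite /= -jE => Mj.
have := Mdiff (n - j ^ 2)%N; rewrite subnKC // => Mn.
have n0 : 0 < n%:R :> R by rewrite ltr0n; nia.
rewrite (gtr0_norm n0) ler_pdivrMr //.
have d : (n - j ^ 2)%:R <= 2 * j%:R :> R by rewrite -natrM ler_nat; nia.
have jn' : j%:R * j%:R <= n%:R :> R by rewrite -natrM ler_nat mulnn.
have j4 : 4 <= e * j%:R.
  by rewrite mulrC -ler_pdivrMr // (le_trans je) // ler_nat.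
have {d}Mn := le_trans Mn d.
have : `|M n| <= `|M (j ^ 2)%N| + `|M n - M (j ^ 2)%N|.
  by rewrite -{1}(subrK (M (j ^ 2)%N) (M n)) addrC ler_normD.
have {}Mj : `|M (j ^ 2)%N| <= e / 2 * (j%:R * j%:R).
  apply: le_trans (ltW Mj) _.
  by rewrite natrX expr2 ler_wpM2r // mulr_ge0.
have : 4 * j%:R <= e * j%:R * j%:R by rewrite ler_wpM2r.
have : e * (j%:R * j%:R) <= e * n%:R by rewrite ler_pM2l.
lra.
Unshelve. all: by end_near. Qed.

(** * Law of large numbers for the degree martingales *)

Lemma attach_inj g h i j : attach g i = attach h j -> g = h /\ i = j.
Proof. by case: g h => [n e s] [m f t] [] *; subst. Qed.

Section SecondMoment.
Context {d : measure_display} {T : measurableType d} {R : realType}.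
Variables (P : probability T R) (G : nat -> T -> graph).
Hypothesis hG : inverse_depreferential P G.

Definition graph_prob n g : R := fine (P (G n @^-1` [set g])).

Lemma graph_probK n g : (2 <= n)%N -> (graph_prob n g)%:E = P (G n @^-1` [set g]).
Proof.
by move=> n2; rewrite fineK // fin_num_measure //; exact: (idp_measurable hG).
Qed.

Lemma graph_prob_ge0 n g : 0 <= graph_prob n g.
Proof. exact: fine_ge0. Qed.

Lemma graph_prob_le1 n g : (2 <= n)%N -> graph_prob n g <= 1.
Proof.
move=> n2; rewrite -lee_fin graph_probK // probability_le1 //.
exact: (idp_measurable hG).
Qed.

(** The conditional law is integrated over the event that [G n] is [g], on which [attach_prob] is
    constant. As [attach] is injective, reaching [attach g i] forces [G n = g] and the choice of
    [i]. *)
Lemma graph_prob_attach n g i : (2 <= n)%N -> (1 <= i <= n)%N ->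
  graph_prob n.+1 (attach g i) = graph_prob n g * attach_prob g i.
Proof.
move=> n2 iN; apply: EFin_inj; rewrite EFinM !graph_probK //; last exact: leqW.
have [_ _ law] := idp_law hG n2 iN.
have mB : measurable (G n @^-1` [set g]) by exact: (idp_measurable hG).
have FB : natural_filtration G n (G n @^-1` [set g]).
  by apply: sub_gen_smallest; exists n, [set g]; rewrite n2 leqnn.
have := law _ FB.
rewrite (eq_integral (cst (attach_prob g i)%:E)); last first.
  by move=> w; rewrite inE /= => ->.
rewrite integral_cst // muleC => ->.
rewrite (_ : G n.+1 @^-1` _ = [set w | G n.+1 w = attach (G n w) i] `&` G n @^-1` [set g]) //.
apply/seteqP; split => w /=; last by case=> -> ->.
have [j _ Gw] := idp_step hG w n2.
by rewrite Gw => /attach_inj[<- <-].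
Qed.

(** The mean of [f] at time [n.+2], written as a finite sum over the possible graphs; [graph_meanS]
    is then the tower property. *)
Definition graph_mean n (f : graph -> R) :=
  \sum_(g <- reachable n) graph_prob n.+2 g * f g.

Lemma graph_meanS n f : graph_mean n.+1 f =
  graph_mean n (fun g => \sum_(1 <= i < n.+3) attach_prob g i * f (attach g i)).
Proof.
rewrite /graph_mean big_allpairs_dep /=; apply: eq_bigr => g _.
rewrite mulr_sumr; apply: eq_big_nat => i iN.
by rewrite graph_prob_attach // mulrA.
Qed.

(** A crude bound suffices: each of the two initial graphs has probability at most one, and
    attachment preserves the total mass. *)
Lemma graph_mean_mass_le2 n : graph_mean n (fun=> 1) <= 2.
Proof.
elim: n => [|n IH].
  rewrite /graph_mean /= !big_cons big_nil !mulr1 addr0.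
  have := graph_prob_le1 (graph2 1) (leqnn 2).
  by have := graph_prob_le1 (graph2 2) (leqnn 2); lra.
rewrite graph_meanS; apply: le_trans IH; rewrite le_eqVlt; apply/orP; left; apply/eqP.
apply: eq_big_seq => g gn; congr (_ * _).
by under eq_bigr do rewrite mulr1; exact: sum_attach_prob.
Qed.

(** The increments have conditional mean zero, so each step adds only a conditional variance
    [r - r ^ 2 <= 1], times a mass of at most two. *)
Lemma deg_martingale_second_moment k n :
  graph_mean n (fun g => deg_martingale k.+1 g ^+ 2) <= 4 * n.+2%:R.
Proof.
elim: n => [|n IH].
  have le4 h : h \in [:: 1; 2]%N -> deg_martingale k.+1 (graph2 h) ^+ 2 <= 4 :> R.
    move=> _; rewrite /deg_martingale /compensator /= subr0 /num_deg_gt /deg_sum /=.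
    by rewrite big_nat_recr //= big_nat1; do 2 case: ltnP => _ /=; lra.
  rewrite /graph_mean /= !big_cons big_nil addr0.
  have h1 := graph_prob_le1 (graph2 1) (leqnn 2).
  have h2 := graph_prob_le1 (graph2 2) (leqnn 2).
  apply: (@le_trans _ _ (1 * 4 + 1 * 4)); last by lra.
  by apply: lerD; apply: ler_pM => //; rewrite ?graph_prob_ge0 ?sqr_ge0 ?le4 ?inE.
rewrite graph_meanS.
apply: (@le_trans _ _ (graph_mean n (fun g => deg_martingale k.+1 g ^+ 2)
    + graph_mean n (fun=> 1))); last first.
  by have := graph_mean_mass_le2 n; rewrite -[n.+3%:R]natr1; lra.
rewrite /graph_mean -big_split /= big_seq [leRHS]big_seq; apply: ler_sum => g gn.
rewrite -mulrDr ler_wpM2l ?graph_prob_ge0 //.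
have wg := well_formed_reachable gn; have [gv _ _ _] := wg.
set m := deg_martingale k.+1 g; pose r : R := rate k.+1 g.
(* The square is linear in the indicator, because the latter is its own square; summing over [i]
   gives [m ^ 2 + r - r ^ 2]. *)
have -> : \sum_(1 <= i < n.+3) attach_prob g i * deg_martingale k.+1 (attach g i) ^+ 2 =
    \sum_(1 <= i < n.+3) ((m - r) ^+ 2 * attach_prob g i +
      (2 * (m - r) + 1) * ((deg g i == k.+1)%:R * attach_prob g i)).
  apply: eq_big_nat => i iN; rewrite (deg_martingale_attach _ wg) // -/m -/r.
  by case: eqP => _ /=; ring.
rewrite big_split /= -[X in X + _]mulr_sumr -[X in _ + X]mulr_sumr.
rewrite (sum_attach_prob gn) -gv -/(rate (R := R) k.+1 g) -/r.
have := rate_ge0 (R := R) k.+1 g; have := rate_le1 (R := R) k.+1 gn; rewrite -/r; nra.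
Qed.

(** A union bound over the list of possible graphs: one with [c <= |f h|] costs its probability, at
    most its share of the second moment over [c ^ 2]; the others cost nothing. *)
Lemma graph_chebyshev n (f : graph -> R) c : 0 < c ->
  (P [set w | (c <= `|f (G n.+2 w)|)%R] <=
   (graph_mean n (fun g => f g ^+ 2) / c ^+ 2)%:E)%E.
Proof.
move=> c0.
have meas S : measurable (G n.+2 @^-1` S) by exact: (idp_measurable hG).
have reach w : G n.+2 w \in reachable n.
  apply: (@reachable_path (fun n => G n w)); first exact: (idp_init hG).
  by move=> m m2; exact: (idp_step hG).
have {reach} -> : [set w | c <= `|f (G n.+2 w)|] =
    G n.+2 @^-1` [set g | g \in reachable n /\ c <= `|f g|].
  by apply/seteqP; split => w /=; [split | case].
rewrite /graph_mean; elim: (reachable n) => [|h s IH].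
  rewrite big_nil mul0r (_ : _ @^-1` _ = set0) ?measure0 //.
  by apply/seteqP; split => w //= [].
rewrite big_cons mulrDl EFinD.
have h0 : 0 <= graph_prob n.+2 h * f h ^+ 2 / c ^+ 2.
  by rewrite divr_ge0 ?sqr_ge0 // mulr_ge0 ?sqr_ge0 // graph_prob_ge0.
have [ch|hc] := leP c `|f h|.
  apply: (@le_trans _ _ (P (G n.+2 @^-1` [set h]) +
     P (G n.+2 @^-1` [set g | g \in s /\ (c <= `|f g|)%R]))%E); last first.
    apply: leeD => //; rewrite -graph_probK // lee_fin -mulrA ler_peMr ?graph_prob_ge0 //.
    by rewrite ler_pdivlMr ?exprn_gt0 // mul1r -(real_normK (num_real (f h)))
      ler_pXn2r // nnegrE ltW.
  apply: le_trans (measureU2 P (meas _) (meas _)).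
  apply: le_measure; rewrite ?inE //; first exact: measurableU.
  by move=> w /= []; rewrite inE => /orP[/eqP -> _|]; [left | right].
rewrite (_ : _ @^-1` _ = G n.+2 @^-1` [set g | g \in s /\ c <= `|f g|]).
  by apply: le_trans IH _; rewrite leeDr // lee_fin.
apply/seteqP; split => w /= [gs cf]; last by rewrite inE gs orbT.
move: gs; rewrite inE => /orP[/eqP E|//].
by move: cf; rewrite E leNgt hc.
Qed.

Let sum_telescope (c : R) N : 0 <= c ->
  \sum_(0 <= j < N) c / (j.+2 ^ 2)%:R <= c :> R.
Proof.
move=> c0; rewrite -mulr_sumr ler_piMr //.
suff : \sum_(0 <= j < N) ((j.+2 ^ 2)%:R)^-1 <= 1 - N.+1%:R^-1 :> R.
  by move=> h; apply: le_trans h _; rewrite gerBl invr_ge0.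
elim: N => [|N IH]; first by rewrite big_geq // invr1 subrr.
rewrite big_nat_recr //=; apply: le_trans (lerD IH (lexx _)) _.
rewrite natrX -[N.+2%:R]natr1; have N1 : 1 <= N.+1%:R :> R by rewrite ler1n.
(* Comparison with the telescoping difference [1 / (N + 1) - 1 / (N + 2)]. *)
have : (N.+1%:R + 1) ^- 2 <= (N.+1%:R * (N.+1%:R + 1))^-1 :> R.
  by rewrite lef_pV2 ?posrE //; nra.
have -> : (N.+1%:R * (N.+1%:R + 1))^-1 = N.+1%:R^-1 - (N.+1%:R + 1)^-1 :> R.
  by field; rewrite !gt_eqF //; lra.
move=> h; rewrite -lerBrDl; apply: le_trans h _.
by rewrite le_eqVlt; apply/orP; left; apply/eqP; ring.
Qed.

Lemma deg_martingale_squares k l : {ae P, forall w,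
  \forall j \near \oo,
    `|deg_martingale k.+1 (G (j.+2 ^ 2)%N w)| < l.+1%:R^-1 * (j.+2 ^ 2)%:R :> R}.
Proof.
pose F j := [set w | l.+1%:R^-1 * (j.+2 ^ 2)%:R <=
  `|deg_martingale k.+1 (G (j.+2 ^ 2)%N w)| :> R].
have j2 j : (2 <= j.+2 ^ 2)%N by rewrite -mulnn; lia.
have mF j : measurable (F j).
  exact: (idp_measurable hG [set g | l.+1%:R^-1 * (j.+2 ^ 2)%:R <=
    `|deg_martingale k.+1 g| :> R]).
(* At time [N = j.+2 ^ 2] Chebyshev gives [4 * N / (N / l.+1) ^ 2 = C / N], summable over [j], so
   Borel-Cantelli applies. *)
pose C : R := 4 * l.+1%:R ^+ 2.
have PF j : (P (F j) <= (C / (j.+2 ^ 2)%:R)%:E)%E.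
  have [m mE] : exists m, (j.+2 ^ 2 = m.+2)%N.
    by exists (j.+2 ^ 2 - 2)%N; have := j2 j; lia.
  rewrite /F mE; have m0 : 0 < m.+2%:R :> R by rewrite ltr0n.
  have l0 : 0 < l.+1%:R :> R by rewrite ltr0n.
  have c0 : 0 < l.+1%:R^-1 * m.+2%:R :> R by rewrite mulr_gt0 ?invr_gt0.
  apply: le_trans (graph_chebyshev m (@deg_martingale R k.+1) c0) _.
  rewrite lee_fin ler_pdivrMr ?exprn_gt0 //.
  apply: le_trans (deg_martingale_second_moment k m) _.
  rewrite le_eqVlt; apply/orP; left; apply/eqP; rewrite /C.
  by field; rewrite !gt_eqF.
have F0 : P (lim_sup_set F) = 0%E.
  apply: lim_sup_set_cvg0 => //; apply: (@le_lt_trans _ _ C%:E); last exact: ltry.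
  apply: lime_le; first by apply: is_cvg_nneseries.
  apply: nearW => N; apply: (@le_trans _ _ (\sum_(0 <= j < N) (C / (j.+2 ^ 2)%:R)%:E)%E).
    by apply: lee_sum => j _; exact: PF.
  by rewrite sumEFin lee_fin sum_telescope // mulr_ge0 ?sqr_ge0.
have mlim : measurable (lim_sup_set F).
  by apply: bigcapT_measurable => n; exact: bigcup_measurable.
exists (lim_sup_set F); split => // w /= Nw N _.
apply: contrapT => wF; apply: Nw; exists N => // j /= Nj.
by rewrite ltNge; apply/negP => Fj; apply: wF; exists j.
Qed.

Lemma deg_martingale_lln : {ae P, forall w, forall k,
  (fun n => deg_martingale k.+1 (G n w) / n%:R) @ \oo --> (0 : R)}.
Proof.
apply/ae_foralln => k.
have := ae_foralln (deg_martingale_squares k); apply: filterS => w Hw.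
apply: (lipschitz_cvg_of_squares (M := fun n => deg_martingale k.+1 (G n w))) => //.
move=> n n2; apply: (@deg_martingale_path_lip (fun n => G n w)) => //.
  exact: (idp_init hG).
by move=> m m2; exact: (idp_step hG).
Qed.

End SecondMoment.

(** * From tail fractions to degree fractions *)

Lemma degree_fractionE {d : measure_display} {T : measurableType d} {R : realType}
    (G : nat -> T -> graph) k n w : nvert (G n w) = n ->
  degree_fraction (R := R) G k.+1 n w =
  num_deg_gt k (G n w) / n%:R - num_deg_gt k.+1 (G n w) / n%:R.
Proof.
move=> gn; rewrite -mulrBl mulrC; congr (_ * _).
rewrite /num_deg_gt /deg_sum gn -sumrB; apply: eq_bigr => i _.
apply: (canRL (addrK _)); rewrite -natrD; congr _%:R; lia.
Qed.

Theorem theorem2p8 (d : measure_display) (T : measurableType d) (R : realType)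
    (P : probability T R) (G : nat -> T -> graph) (lambda : R)
    (hG : inverse_depreferential P G)
    (lambda_gt0 : 0 < lambda)
    (hlambda : (fun N : nat => \sum_(1 <= n < N.+1)
        \prod_(1 <= i < n.+1) (1 / (1 + i%:R * lambda))) @ \oo --> (1 : R))
    (k : nat) (k_ge1 : (1 <= k)%N) :
  {ae P, forall w, (fun n : nat => degree_fraction (R := R) G k n w) @ \oo -->
    (k%:R * lambda / (k%:R * lambda + 1)
     * \prod_(1 <= i < k) (1 / (i%:R * lambda + 1)) : R)}.
Proof.
case: k k_ge1 => // k _; apply: filterS (deg_martingale_lln hG) => w mart.
have init := idp_init hG w.
have step n (n2 : (2 <= n)%N) := idp_step hG w n2.
have tail := frac_deg_gt_cvg init step lambda_gt0 hlambda mart.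
(* The limit is a difference of consecutive tails: [u_k - u_(k+1)] is [u_k] times
   [1 - 1 / (1 + k.+1 * lambda)]. *)
have -> : k.+1%:R * lambda / (k.+1%:R * lambda + 1)
     * \prod_(1 <= i < k.+1) (1 / (i%:R * lambda + 1)) =
    tail_prod lambda k - tail_prod lambda k.+1.
  under eq_bigr do rewrite addrC; rewrite -/(tail_prod lambda k).
  rewrite (tail_prodS k lambda_gt0); field.
  by rewrite gt_eqF // ltr_wpDl // mulr_ge0 // ltW.
apply: cvg_trans (cvgB (tail k) (tail k.+1)).
apply: near_eq_cvg; near=> n.
have n2 : (2 <= n)%N by near: n; exact: nbhs_infty_ge.
by rewrite degree_fractionE //; case: (well_formed_path init step n2).
Unshelve. all: by end_near. Qed.
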